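(* Let $I\subset\mathbb{R}[x_1,\dots,x_n]$ be an ideal. If there exists $w\in(\mathbb{R}_{>0})^n$ with $\operatorname{in}_w(I)$ real radical, then the preorder $\sum\mathbb{R}[x_1,\dots,x_n]^2+I$ is stable. If $I$ is homogeneous and $\Delta_{\mathbb{R}\mathrm{ad}}(I)\neq\emptyset$, then $\sum\mathbb{R}[x_1,\dots,x_n]^2+I$ is stable.
   Context: Initial forms: for $w\in\mathbb{R}^n$ and a nonzero polynomial $f=\sum_a f_a x^a$, $\deg_w(f)=\max\{w^Ta : f_a\ne0\}$ and $\operatorname{in}_w(f)=\sum_{a:\,w^Ta=\deg_w(f)}f_a x^a$; $\operatorname{in}_w(0)=0$. For an ideal $I$, $\operatorname{in}_w(I)=\langle \operatorname{in}_w(f): f\in I\rangle$. Real radical: an ideal $J\subset\mathbb{R}[x_1,\dots,x_n]$ is real radical if $J=\sqrt[\mathbb{R}]{J}$, where $\sqrt[\mathbb{R}]{J}=\{f : -f^{2m}\in\sum\mathbb{R}[x_1,\dots,x_n]^2+J\text{ for some integer } m\geq 1\}$; equivalently $\sqrt[\mathbb{R}]{J}$ is the set of all polynomials vanishing on the real zero set of $J$. Here $\sum\mathbb{R}[x_1,\dots,x_n]^2$ is the set of finite sums of squares of polynomials. Gröbner fan: for a homogeneous ideal $I$ (standard grading), the equivalence classes of the relation $w\sim v\iff\operatorname{in}_w(I)=\operatorname{in}_v(I)$ on $\mathbb{R}^n$ are finitely many relatively open rational polyhedral cones, and their closures form a fan $\Delta_{Gr}(I)$. Then $\Delta_{\mathbb{R}\mathrm{ad}}(I)=\{\sigma\in\Delta_{Gr}(I):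 \operatorname{in}_w(I)\text{ is real radical for }w\in\operatorname{relint}(\sigma)\}$; thus for homogeneous $I$, $\Delta_{\mathbb{R}\mathrm{ad}}(I)\ne\emptyset$ means that $\operatorname{in}_v(I)$ is real radical for some $v\in\mathbb{R}^n$. Stability: a quadratic module $P=QM(p_1,\dots,p_r)=\{\sum_{i=0}^r\sigma_ip_i:\sigma_i\in\sum\mathbb{R}[x_1,\dots,x_n]^2\}$ (with $p_0=1$) is stable if there exists a function $l:\mathbb{N}\to\mathbb{N}$ such that for every (nonzero) $f\in P$ there are $\sigma_0,\dots,\sigma_r\in\sum\mathbb{R}[x_1,\dots,x_n]^2$ with $f=\sum_{i=0}^r\sigma_ip_i$ and $\deg(\sigma_ip_i)\le l(\deg(f))$ for each $i$. The set $\sum\mathbb{R}[x_1,\dots,x_n]^2+I$ is regarded as the quadratic module $QM(h_1,-h_1,\dots,h_t,-h_t)$, where $h_1,\dots,h_t$ is any finite generating set of $I$ (stability does not depend on the choice). *)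

(* Defs.v *)
(* mpoly must be imported before the MathComp-Analysis files: the opposite
   order fails with a notation clash. *)
From HB Require Import structures.
From mathcomp Require Import all_boot all_order all_algebra.
From mathcomp Require Import mpoly.
From mathcomp Require Import boolp classical_sets reals topology.

Set Implicit Arguments.
Unset Strict Implicit.
Unset Printing Implicit Defensive.

Import Order.TTheory GRing.Theory Num.Theory.
Import numFieldTopology.Exports.

Local Open Scope classical_set_scope.
Local Open Scope ring_scope.

Section Ideals.
Context {R : realType} {n : nat}.
Implicit Types (I J S : set {mpoly R[n]}) (f : {mpoly R[n]}).

Definition is_ideal I : Prop :=
  [/\ I 0, forall f g, I f -> I g -> I (f + g) & forall f g, I g -> I (f * g)].

Definition ideal_gen S : set {mpoly R[n]} :=
  [set f | exists k (q g : 'I_k -> {mpoly R[n]}),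
     (forall i, S (g i)) /\ f = \sum_(i < k) q i * g i].

Definition homogeneous_ideal I : Prop :=
  exists S : set {mpoly R[n]},
    (forall f, S f -> exists d : nat, f \is d.-homog) /\ I = ideal_gen S.

Definition sos : set {mpoly R[n]} :=
  [set f | exists s : seq {mpoly R[n]}, f = \sum_(g <- s) g ^+ 2].

Definition sos_plus J : set {mpoly R[n]} :=
  [set f | exists s g, [/\ sos s, J g & f = s + g]].

Definition real_radical J : set {mpoly R[n]} :=
  [set f | exists m : nat, (1 <= m)%N /\ sos_plus J (- f ^+ (2 * m))].

Definition is_real_radical J : Prop := J = real_radical J.

End Ideals.

Section InitialIdeals.
Context {R : realType} {n : nat}.
Implicit Types (w v : 'rV[R]_n) (I : set {mpoly R[n]}) (f : {mpoly R[n]}).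

Definition wdot w (a : 'X_{1..n}) : R := \sum_(i < n) w ord0 i * (a i)%:R.

(* For f != 0 the default value is attained on the support, since
   mlead f \in msupp f, so this is the maximum over msupp f. *)
Definition wdeg w f : R :=
  \big[Num.max/wdot w (mlead f)]_(a <- msupp f) wdot w a.

Definition in_form w f : {mpoly R[n]} :=
  \sum_(a <- msupp f | wdot w a == wdeg w f) f@_a *: 'X_[a].

Definition in_ideal w I : set {mpoly R[n]} := ideal_gen (in_form w @` I).

End InitialIdeals.

Section RelativeInterior.
Context {R : realType} {n : nat}.
Implicit Types (S : set 'rV[R]_n).

Definition affine_hull S : set 'rV[R]_n :=
  [set v | exists k (a : 'I_k -> R) (u : 'I_k -> 'rV[R]_n),
     [/\ forall i, S (u i), \sum_(i < k) a i = 1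
       & v = \sum_(i < k) a i *: u i]].

Definition relint S : set 'rV[R]_n :=
  [set w | S w /\ exists2 U, nbhs w U & U `&` affine_hull S `<=` S].

End RelativeInterior.

Section GroebnerFan.
Context {R : realType} {n : nat}.
Implicit Types (w v : 'rV[R]_n) (I : set {mpoly R[n]}).

Definition groebner_class I w : set 'rV[R]_n :=
  [set v | in_ideal v I = in_ideal w I].

Definition groebner_fan I : set (set 'rV[R]_n) :=
  [set sigma | exists w, sigma = closure (groebner_class I w)].

(* For homogeneous I, the relative interior of a cone of the fan is one
   (nonempty) equivalence class, on which in_ideal w I is constant; being real
   radical for some w in it is the same as for every w in it. *)
Definition real_radical_fan I : set (set 'rV[R]_n) :=
  [set sigma | groebner_fan I sigma /\
     exists2 w, relint sigma w & is_real_radical (in_ideal w I)].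

End GroebnerFan.

Section Stability.
Context {R : realType} {n : nat}.
Implicit Types (p hs : seq {mpoly R[n]}) (f : {mpoly R[n]}).

(* (1 :: p)`_i runs through p_0 = 1, p_1, ..., p_r. *)
Definition qm_repr p f (s : 'I_(size p).+1 -> {mpoly R[n]}) : Prop :=
  (forall i, sos (s i)) /\ f = \sum_(i < (size p).+1) s i * (1 :: p)`_i.
Arguments qm_repr : clear implicits.

Definition quadratic_module p : set {mpoly R[n]} :=
  [set f | exists s, qm_repr p f s].

(* Total degree; msize is degree + 1 for nonzero polynomials and 0 for 0, so
   mtdeg 0 = 0. *)
Definition mtdeg f : nat := (msize f).-1.

Definition qm_stable p : Prop :=
  exists l : nat -> nat, forall f, f != 0 -> quadratic_module p f ->
    exists2 s, qm_repr p f s &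
      forall i : 'I_(size p).+1, (mtdeg (s i * (1 :: p)`_i) <= l (mtdeg f))%N.

Definition plus_minus hs : seq {mpoly R[n]} :=
  flatten [seq [:: h; - h] | h <- hs].

(* Stability of the preorder sos_plus I, viewed as the quadratic module
   QM(h_1, -h_1, ..., h_t, -h_t) for any finite generating set of I (one
   exists by Hilbert's basis theorem). *)
Definition sos_plus_stable (I : set {mpoly R[n]}) : Prop :=
  forall hs, I = ideal_gen [set h | h \in hs] -> qm_stable (plus_minus hs).

End Stability.

(* Main.v *)
(** Let [w > 0] with [in_w I] real radical and [f = sum g_i^2 + h], [h] in [I].
If the largest [w]-degree [r] of the [g_i] exceeds [deg_w f / 2], then the
weight-[2r] part of the identity puts the sum of squares of the weight-[r] parts
of the [g_i] in [in_w I]; by real radicality each of these parts is the top part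
of an element of [I], which can be subtracted from [g_i] at the expense of [h].
Since [w > 0], only finitely many weights lie below a given bound, so this ends
with [deg_w g_i <= deg_w f / 2], which bounds the degrees of the [g_i] and of
[h] in terms of [deg f]; elements of [I] of bounded degree form a
finite-dimensional space, hence have representations of bounded degree.
For homogeneous [I], [in_w I] is unchanged by adding a constant vector to [w],
so [w] may be taken positive. *)

From HB Require Import structures.
Require Import Defs.
From mathcomp Require Import all_boot all_order all_algebra.
From mathcomp Require Import mpoly.
From mathcomp Require Import ring lra.
From mathcomp Require Import boolp classical_sets reals topology.

Set Implicit Arguments.
Unset Strict Implicit.
Unset Printing Implicit Defensive.

Import Order.TTheory GRing.Theory Num.Theory.
Import numFieldTopology.Exports.
Local Open Scope classical_set_scope.
Local Open Scope ring_scope.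

(** * Closure properties of ideals and sums of squares *)

Section Ideals.
Context {R : realType} {n : nat}.
Implicit Types (I J S : set {mpoly R[n]}) (f g h : {mpoly R[n]}).

Section Closure.
Variables (I : set {mpoly R[n]}) (idI : is_ideal I).

Lemma ideal0 : I 0. Proof. by case: idI. Qed.

Lemma idealD f g : I f -> I g -> I (f + g).
Proof. by case: idI => _ + _; apply. Qed.

Lemma idealM f g : I g -> I (f * g).
Proof. by case: idI => _ _; apply. Qed.

Lemma idealN f : I f -> I (- f).
Proof. by rewrite -mulN1r; apply: idealM. Qed.

Lemma idealB f g : I f -> I g -> I (f - g).
Proof. by move=> If Ig; apply: idealD => //; apply: idealN. Qed.

Lemma idealZ c f : I f -> I (c *: f).
Proof. by rewrite -mul_mpolyC; apply: idealM. Qed.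

Lemma ideal_sum (T : eqType) (s : seq T) (F : T -> {mpoly R[n]}) :
  (forall x, x \in s -> I (F x)) -> I (\sum_(x <- s) F x).
Proof.
by move=> IF; rewrite big_seq; apply: big_rec => [|x f xs If];
  [exact: ideal0 | apply: idealD => //; apply: IF].
Qed.

Lemma ideal_gen_sub S : S `<=` I -> ideal_gen S `<=` I.
Proof.
move=> SI f [k [q [g [Sg ->]]]]; apply: ideal_sum => i _.
by apply: idealM; apply: SI.
Qed.

End Closure.

Lemma sub_ideal_gen S : S `<=` ideal_gen S.
Proof.
move=> f Sf; exists 1, (fun _ => 1), (fun _ => f); split=> //.
by rewrite big_ord1 mul1r.
Qed.

Lemma ideal_gen_ideal S : is_ideal (ideal_gen S).
Proof.
split.
- by exists 0, (fun _ => 0), (fun _ => 0); split=> [[]//|]; rewrite big_ord0.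
- move=> f g [k [q [u [Su ->]]]] [l [r [v [Sv ->]]]].
  exists (k + l)%N,
    (fun i => match split i with inl a => q a | inr b => r b end),
    (fun i => match split i with inl a => u a | inr b => v b end).
  split; first by move=> i; case: splitP.
  rewrite big_split_ord /=; congr (_ + _); apply: eq_bigr => i _.
  + by have /= -> := unsplitK (inl i : 'I_k + 'I_l).
  + by have /= -> := unsplitK (inr i : 'I_k + 'I_l).
- move=> f _ [k [q [u [Su ->]]]]; exists k, (fun i => f * q i), u; split=> //.
  by rewrite mulr_sumr; apply: eq_bigr => i _; rewrite mulrA.
Qed.

Lemma sos0 : sos (0 : {mpoly R[n]}).
Proof. by exists [::]; rewrite big_nil. Qed.

Lemma sosX2 f : sos (f ^+ 2).
Proof. by exists [:: f]; rewrite big_seq1. Qed.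

End Ideals.

(** * Weight components and weight bounds of polynomials *)

Section Weights.
Context {R : realType} {n : nat}.
Implicit Types (w v : 'rV[R]_n) (f g h u q : {mpoly R[n]}) (r s c : R).

Lemma wdotD w a b : wdot w (a + b)%MM = wdot w a + wdot w b.
Proof.
by rewrite /wdot -big_split; apply: eq_bigr => i _; rewrite mnmDE natrD mulrDr.
Qed.

Lemma wdot_const c (a : 'X_{1..n}) : wdot (const_mx c) a = c * (mdeg a)%:R.
Proof.
by rewrite mdegE natr_sum mulr_sumr; apply: eq_bigr => i _; rewrite mxE.
Qed.

Lemma wdotDl w v a : wdot (w + v) a = wdot w a + wdot v a.
Proof.
by rewrite /wdot -big_split; apply: eq_bigr => i _; rewrite mxE mulrDl.
Qed.

Lemma le_wdot w v a :
  (forall i, w ord0 i <= v ord0 i) -> wdot w a <= wdot v a.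
Proof. by move=> wv; apply: ler_sum => i _; apply: ler_wpM2r. Qed.

(** For fixed [r] this is linear in [f], unlike [in_form], so it can be applied to an identity in
    which top parts cancel. *)
Definition wcomp w r f : {mpoly R[n]} :=
  \sum_(a <- msupp f | wdot w a == r) f@_a *: 'X_[a].

(** An upper bound instead of an exact degree: it survives cancellation in sums and holds for 0 with
    every [r]. *)
Definition wle w r f : Prop := forall a, a \in msupp f -> wdot w a <= r.

Definition whomog w r f : Prop := forall a, a \in msupp f -> wdot w a = r.

Lemma mcoeff_wcomp w r f a :
  (wcomp w r f)@_a = if wdot w a == r then f@_a else 0.
Proof.
rewrite /wcomp linear_sum /=.
under eq_bigr do rewrite mcoeffZ mcoeffX.
have [fa|fa] := boolP (a \in msupp f); last first.
  rewrite (memN_msupp_eq0 fa) if_same big_seq_cond big1 // => b /andP[fb _].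
  by case: eqVneq fb fa => [->->//|]; rewrite mulr0.
rewrite big_mkcond (bigD1_seq a) //= ?msupp_uniq // big1 ?addr0.
  by rewrite eqxx mulr1.
by move=> b /negPf ->; rewrite mulr0 if_same.
Qed.

Lemma wcomp_is_linear w r : linear (wcomp w r).
Proof.
move=> c f g; apply/mpolyP => a.
rewrite !(mcoeffD, mcoeffZ, mcoeff_wcomp).
by case: ifP => // _; rewrite mulr0 addr0.
Qed.

HB.instance Definition _ w r :=
  GRing.isLinear.Build R {mpoly R[n]} {mpoly R[n]} _ (wcomp w r)
    (wcomp_is_linear w r).

Lemma mem_msupp f a : (a \in msupp f) = (f@_a != 0).
Proof. by rewrite mcoeff_eq0 negbK. Qed.

Lemma msupp_wcomp w r f a :
  (a \in msupp (wcomp w r f)) = (wdot w a == r) && (a \in msupp f).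
Proof.
by rewrite !mem_msupp mcoeff_wcomp; case: ifP => //= _; rewrite eqxx.
Qed.

Lemma whomog_wcomp w r f : whomog w r (wcomp w r f).
Proof. by move=> a; rewrite msupp_wcomp => /andP[/eqP]. Qed.

Lemma wcomp_whomog w r s f :
  whomog w s f -> wcomp w r f = if s == r then f else 0.
Proof.
move=> hf; apply/mpolyP => a; rewrite mcoeff_wcomp.
have [/hf ->|/memN_msupp_eq0 fa] := boolP (a \in msupp f).
  by case: ifP; rewrite ?mcoeff0.
by case: ifP; case: ifP; rewrite ?mcoeff0.
Qed.

Lemma wcomp_eq0 w r f :
  (forall a, a \in msupp f -> wdot w a != r) -> wcomp w r f = 0.
Proof.
move=> hf; apply/mpolyP => a; rewrite mcoeff_wcomp mcoeff0.
case: ifPn => // war; apply: memN_msupp_eq0.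
by apply: contraL war; apply: hf.
Qed.

Lemma wle0 w r : wle w r 0.
Proof. by move=> a; rewrite msupp0. Qed.

Lemma wleW w r s f : r <= s -> wle w r f -> wle w s f.
Proof. by move=> rs hf a /hf /le_trans; apply. Qed.

Lemma wleD w r f g : wle w r f -> wle w r g -> wle w r (f + g).
Proof.
by move=> hf hg a /msuppD_le; rewrite mem_cat => /orP[/hf|/hg].
Qed.

Lemma wleZ w r c f : wle w r f -> wle w r (c *: f).
Proof. by move=> hf a /msuppZ_le /hf. Qed.

Lemma wleN w r f : wle w r f -> wle w r (- f).
Proof. by rewrite -scaleN1r; apply: wleZ. Qed.

Lemma wle_sum w r (T : eqType) (s : seq T) (F : T -> {mpoly R[n]}) :
  (forall x, x \in s -> wle w r (F x)) -> wle w r (\sum_(x <- s) F x).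
Proof.
move=> hF; rewrite big_seq; apply: big_rec => [|x f xs hf]; first exact: wle0.
by apply: wleD => //; apply: hF.
Qed.

Lemma wleM w r s f g : wle w r f -> wle w s g -> wle w (r + s) (f * g).
Proof.
move=> hf hg _ /msuppM_le /allpairsP[[a b] /= [fa gb ->]].
by rewrite wdotD lerD ?hf ?hg.
Qed.

Lemma whomog_wle w r f : whomog w r f -> wle w r f.
Proof. by move=> hf a /hf ->. Qed.

Lemma wcompMr w r s q u :
  whomog w s u -> wcomp w r (q * u) = wcomp w (r - s) q * u.
Proof.
move=> hu; rewrite {1}(mpolyE q) mulr_suml linear_sum /= /wcomp mulr_suml.
rewrite [RHS]big_mkcond; apply: eq_bigr => a _.
rewrite -/(wcomp w r _) (@wcomp_whomog w r (wdot w a + s)).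
  by rewrite eq_sym -subr_eq eq_sym; case: ifP.
move=> b; rewrite -scalerAl => /msuppZ_le /msuppM_le /allpairsP[[c d] /=].
by rewrite msuppX inE => -[/eqP -> /hu <- ->]; rewrite wdotD.
Qed.

Lemma wcompM w r s f g : wle w r f -> wle w s g ->
  wcomp w (r + s) (f * g) = wcomp w r f * wcomp w s g.
Proof.
move=> hf hg.
(* Split off the weight-[r] part of [f]: the remainder has weights strictly below [r], so its
   product with [g] stays strictly below [r + s]. *)
rewrite -[f in LHS](subrK (wcomp w r f)) mulrDl linearD /= wcomp_eq0 ?add0r.
  rewrite mulrC (wcompMr _ _ (@whomog_wcomp w r f)) mulrC.
  by rewrite (_ : r + s - r = s) //; ring.
move=> _ /msuppM_le /allpairsP[[a b] /= [fa gb ->]].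
have {fa} [fa ra] : a \in msupp f /\ wdot w a != r.
  move: fa; rewrite !mem_msupp mcoeffB mcoeff_wcomp.
  by case: ifP => _; rewrite ?subrr ?eqxx // subr0.
rewrite wdotD; have := hf a fa; have := hg b gb; lra.
Qed.

Lemma wle_wdeg w f : wle w (wdeg w f) f.
Proof. by move=> a fa; exact: (le_bigmax_seq _ a predT _ fa isT). Qed.

Lemma wdeg_eq w r f a :
  wle w r f -> a \in msupp f -> wdot w a = r -> wdeg w f = r.
Proof.
move=> hf fa war; apply/eqP; rewrite eq_le -{2}war wle_wdeg // andbT.
rewrite /wdeg big_seq_cond; apply: bigmax_le => [|b /andP[/hf]//].
(* The default value of the maximum is the weight of [mlead f], which lies in the support because
   [f] is nonzero. *)
by apply: hf; apply: mlead_supp; apply: contraTneq fa => ->; rewrite msupp0.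
Qed.

End Weights.

(** * Initial ideals and the reduction of sums of squares *)

Section InitialIdeals.
Context {R : realType} {n : nat}.
Implicit Types (w v : 'rV[R]_n) (I S : set {mpoly R[n]}).
Implicit Types (f g h u q : {mpoly R[n]}) (r s c : R).

Lemma in_form_wcomp w f : in_form w f = wcomp w (wdeg w f) f.
Proof. by []. Qed.

(** If the weight [r] occurs in [h], the component is the initial form of [h]; otherwise it is 0. *)
Lemma in_ideal_wcomp w I r h :
  I h -> wle w r h -> in_ideal w I (wcomp w r h).
Proof.
move=> Ih hr.
have [|/negP hn] := boolP (has (fun a => wdot w a == r) (msupp h)).
  move=> /hasP[a ha /eqP war]; apply: sub_ideal_gen; exists h => //.
  by rewrite in_form_wcomp (wdeg_eq hr ha war).
rewrite wcomp_eq0; first exact: (ideal0 (ideal_gen_ideal _)).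
by move=> a ha; apply/negP => war; apply: hn; apply/hasP; exists a.
Qed.

Lemma in_ideal_lift w I r f : is_ideal I -> in_ideal w I f -> whomog w r f ->
  exists h, [/\ I h, wle w r h & wcomp w r h = f].
Proof.
move=> idI [k [q [g [gI ->]]]] fr.
have /choice[e eP] : forall i, exists h, I h /\ in_form w h = g i.
  by move=> i; have [h] := gI i; exists h.
pose d i := wdeg w (e i).
(* Only the part of [q i] of weight [r - d i] contributes to weight [r]; keeping just this part
   prevents the lift from exceeding [r]. *)
pose qi i := wcomp w (r - d i) (q i).
exists (\sum_i qi i * e i); split.
- by apply: ideal_sum => // i _; apply: idealM => //; case: (eP i).
- apply: wle_sum => i _; rewrite -(subrK (d i) r); apply: wleM.
    by apply: whomog_wle; apply: whomog_wcomp.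
  exact: wle_wdeg.
- have := wcomp_whomog r fr; rewrite eqxx => <-.
  rewrite !linear_sum; apply: eq_bigr => i _ /=; case: (eP i) => _ <-.
  rewrite in_form_wcomp (wcompMr _ _ (@whomog_wcomp _ _ w (d i) (e i))).
  rewrite mulrC (wcompMr _ _ (@whomog_wcomp _ _ w (r - d i) (q i))) mulrC.
  by rewrite (_ : r - (r - d i) = d i) //; ring.
Qed.

(* If the top weight [r] of the [g]'s exceeds [s], their weight-[r] parts have
   squares summing to a form of [in_w I], so each of them lies in [in_w I]. *)
Lemma sos_top_reduction w I f gs h r s : is_ideal I ->
  is_real_radical (in_ideal w I) ->
  I h -> f = \sum_(g <- gs) g ^+ 2 + h -> wle w (2 * s) f -> s < r ->
  (forall g, g \in gs -> wle w r g) ->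
  forall g, g \in gs -> in_ideal w I (wcomp w r g).
Proof.
(* The exponent 2 suffices: weight [r + r] does not occur in [f], so minus the square of the top
   part of [g] is the sum of the other squared top parts plus a component of [h]. *)
move=> idI rad Ih fE fs sr gsr g gs_g; rewrite rad; exists 1%N; split=> //.
have sumr : wle w (r + r) (\sum_(g <- gs) g ^+ 2).
  by apply: wle_sum => k gs_k; rewrite expr2; apply: wleM; apply: gsr.
have hr : wle w (r + r) h.
  rewrite (_ : h = f - \sum_(g <- gs) g ^+ 2); last by rewrite fE; ring.
  by apply: wleD; [apply: wleW fs; lra | apply: wleN].
exists (\sum_(k <- rem g gs) wcomp w r k ^+ 2), (wcomp w (r + r) h); split.
- by exists [seq wcomp w r k | k <- rem g gs]; rewrite big_map.
- exact: in_ideal_wcomp.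
have : wcomp w (r + r) f = 0.
  by apply: wcomp_eq0 => a /fs; apply: contraTneq => ->; rewrite -ltNge; lra.
rewrite fE linearD linear_sum /= => /eqP; rewrite big_seq.
under eq_bigr => k gs_k do rewrite expr2 (wcompM (gsr k gs_k) (gsr k gs_k)).
rewrite -big_seq (big_rem g) //= -addrA addrC addr_eq0 => /eqP.
by under eq_bigr do rewrite -expr2; rewrite muln1 expr2 => ->.
Qed.

Lemma mdeg_le_wdot w a c :
  (forall i, c <= w ord0 i) -> c * (mdeg a)%:R <= wdot w a.
Proof. by move=> cw; rewrite -wdot_const; apply: le_wdot => i; rewrite mxE. Qed.

(** Induction on the number of exponents with weight strictly between [s] and a strict upper bound
    [r] for the weights in [gs]; each reduction step lowers [r]. *)
Lemma sos_plus_wle w I c f gs h s : is_ideal I ->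
  0 < c -> (forall i, c <= w ord0 i) ->
  is_real_radical (in_ideal w I) ->
  I h -> f = \sum_(g <- gs) g ^+ 2 + h -> wle w (2 * s) f ->
  exists gs' h', [/\ I h', f = \sum_(g <- gs') g ^+ 2 + h'
    & forall g, g \in gs' -> wle w s g].
Proof.
move=> idI c0 cw rad Ih fE fs.
have [r0 gsr0] : exists r0, forall g a,
    g \in gs -> a \in msupp g -> wdot w a < r0.
  exists (1 + \big[Num.max/s]_(g <- gs) wdeg w g) => g a.
  move=> gs_g /(@wle_wdeg _ _ w) /le_lt_trans; apply.
  by have := le_bigmax_seq s g predT (wdeg w) gs_g isT; lra.
(* An exponent of weight below [r0] has total degree below [r0 / c], so finitely many exponents are
   involved. *)
pose B := (Num.bound (r0 / c)).+1.
have boundB a : wdot w a < r0 -> (mdeg a < B)%N.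
  move=> /(le_lt_trans (mdeg_le_wdot a cw)) ar0.
  have le_ac : (mdeg a)%:R <= r0 / c by rewrite ler_pdivlMr // mulrC ltW.
  rewrite ltnS -(ler_nat R) (le_trans le_ac) // ltW // archi_boundP //.
  exact: le_trans le_ac.
pose T r := [set b : 'X_{1..n < B} | s < wdot w b < r]%SET.
have [k] := ubnP #|T r0|; have := lexx r0.
(* The degree bound [B] stays tied to the initial [r0], while the current bound [r <= r0]
   decreases. *)
elim: k {1 2 4}r0 gs h Ih fE gsr0 => // k IHk r gs h Ih fE gsr rr0 Tk.
have [T0|[b0 Tb0]] := set_0Vmem (T r).
  exists gs, h; split=> // g gs_g a ga; rewrite leNgt; apply/negP => sa.
  have ar := gsr _ _ gs_g ga.
  have aB := boundB a (lt_le_trans ar rr0).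
  by move/setP/(_ (BMultinom aB)): T0; rewrite !inE /= sa ar.
have [b Tb bmax] : exists2 b, b \in T r &
    forall b', b' \in T r -> wdot w b' <= wdot w b.
  by case: (@arg_maxP _ _ _ b0 (mem (T r)) (fun b => wdot w (bmnm b)) Tb0) => b;
    exists b.
have {b0 Tb0} := Tb; rewrite inE => /andP[sb br].
have gsb g : g \in gs -> wle w (wdot w b) g.
  move=> gs_g a ga; have ar := gsr _ _ gs_g ga.
  have aB := boundB a (lt_le_trans ar rr0).
  have [sa|/le_trans->//] := ltP s (wdot w a); last exact: ltW.
  by apply: (bmax (BMultinom aB)); rewrite inE /= sa.
have /choice[e eP] : forall g, exists e, g \in gs ->
    [/\ I e, wle w (wdot w b) e & wcomp w (wdot w b) e = wcomp w (wdot w b) g].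
  move=> g; have [gs_g|_] := boolP (g \in gs); last by exists 0.
  have /(in_ideal_lift idI)/(_ (@whomog_wcomp _ _ w _ g))[e he] :=
    sos_top_reduction idI rad Ih fE fs sb gsb gs_g.
  by exists e.
(* Uses [g^2 = (g - e)^2 + (2 g - e) e], the last term going into [h]. As [g] and [e g] have the
   same part of weight [wdot w b], this weight becomes the new strict bound, and [b] leaves the set
   [T]. *)
apply: (IHk (wdot w b) [seq g - e g | g <- gs]
  (h + \sum_(g <- gs) (2 * g - e g) * e g)).
- apply: idealD => //; apply: ideal_sum => // g /eP[Ie _ _].
  exact: idealM.
- rewrite big_map addrCA -big_split /= fE addrC; congr (_ + _).
  by apply: eq_bigr => g _; ring.
- move=> _ a /mapP[g gs_g ->] ga; have [Ie er eg] := eP g gs_g.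
  have := wleD (gsb g gs_g) (wleN er) ga; rewrite le_eqVlt => /orP[/eqP ab|//].
  move: ga; rewrite mem_msupp mcoeffB.
  move/(congr1 (fun p => p@_a)): eg.
  by rewrite !mcoeff_wcomp ab eqxx => ->; rewrite subrr eqxx.
- by apply: le_trans rr0; apply: ltW.
- rewrite -ltnS; apply: leq_trans Tk; rewrite ltnS; apply: proper_card.
  apply/properP; split.
    by apply/fintype.subsetP => b'; rewrite !inE => /andP[-> /lt_trans]; apply.
  by exists b => //; rewrite inE ltxx andbF.
Qed.

End InitialIdeals.

(** * Degree bounds for representations of ideal elements *)

Section BoundedRepresentations.
Context {R : realType} {n : nat}.
Implicit Types (I : set {mpoly R[n]}) (f g h : {mpoly R[n]}).
Implicit Types (hs : seq {mpoly R[n]}).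

(** Total degree is the weight for the all-ones vector, so the lemmas on [wle] apply. *)
Definition degle (B : nat) f : Prop := wle (const_mx 1) B%:R f.

Lemma degleP B f : degle B f <-> (forall a, a \in msupp f -> (mdeg a <= B)%N).
Proof.
by split=> fB a /fB; rewrite wdot_const mul1r ler_nat.
Qed.

Lemma degle_mtdeg f : degle (mtdeg f) f.
Proof.
apply/degleP => a /msize_mdeg_lt; rewrite /mtdeg.
by case: (msize f).
Qed.

Lemma mtdeg_le B f : degle B f -> (mtdeg f <= B)%N.
Proof.
move=> /degleP fB.
suff : (msize f <= B.+1)%N by rewrite /mtdeg; case: (msize f).
rewrite msizeE.
by apply/bigmax_leqP_seq => a fa _; apply: fB.
Qed.

Lemma degleW B B' f : (B <= B')%N -> degle B f -> degle B' f.
Proof. by move=> BB'; apply: wleW; rewrite ler_nat. Qed.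

Lemma degleM B B' f g : degle B f -> degle B' g -> degle (B + B') (f * g).
Proof. by rewrite /degle natrD; apply: wleM. Qed.

Lemma degle1 B : degle B 1.
Proof.
by move=> a; rewrite msupp1 inE => /eqP ->; rewrite wdot_const mdeg0 mulr0.
Qed.

(* Gaussian elimination on the monomials of [L], so that finitely many
   elements of [V] control all of them. *)
Lemma uniform_bound (V : set {mpoly R[n]}) (Q : nat -> set {mpoly R[n]})
    (L : seq 'X_{1..n}) :
  (forall c f g, V f -> V g -> V (f - c *: g)) ->
  Q 0%N 0 -> (forall B B' f, (B <= B')%N -> Q B f -> Q B' f) ->
  (forall B c f g, Q B f -> Q B g -> Q B (f + c *: g)) ->
  (forall f, V f -> exists B, Q B f) ->
  exists B, forall f, V f -> {subset msupp f <= L} -> Q B f.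
Proof.
move=> Vlin Q0 Qmon Qlin VQ; elim: L => [|a L [B BP]].
  exists 0%N => f _ f0; suff -> : f = 0 by [].
  apply/mpolyP => a; rewrite mcoeff0; apply: memN_msupp_eq0.
  by apply/negP => /f0.
have [[g [Vg gL ga]]|noa] := EM (exists g,
    [/\ V g, {subset msupp g <= a :: L} & g@_a != 0]).
  have [B' B'P] := VQ g Vg.
  (* Subtracting [c *: g] cancels the monomial [a] and leaves an element supported on [L], to which
     the bound [B] applies. *)
  exists (maxn B B') => f Vf fL; pose c := f@_a / g@_a.
  rewrite -(subrK (c *: g) f); apply: Qlin; last first.
    by apply: Qmon B'P; apply: leq_maxr.
  apply: (Qmon B); [exact: leq_maxl | apply: BP; first exact: Vlin].
  move=> b; rewrite mem_msupp mcoeffB mcoeffZ => fgb.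
  have ba : b != a by apply: contraNneq fgb => ->; rewrite divfK ?subrr.
  suff : b \in a :: L by rewrite inE (negPf ba).
  have [/fL//|/memN_msupp_eq0 fb] := boolP (b \in msupp f).
  apply: gL; rewrite mem_msupp; apply: contraNneq fgb => ->.
  by rewrite fb mulr0 subrr.
exists B => f Vf fL; apply: BP => // b fb.
have := fL b fb; rewrite inE => /orP[/eqP ba|//]; case: noa.
by exists f; split=> //; rewrite -mem_msupp -ba.
Qed.

(** Combinations with one coefficient per position of [hs] already form an ideal containing each
    member of [hs]. *)
Lemma ideal_gen_seq hs f : ideal_gen [set h | h \in hs] f ->
  exists q : nat -> {mpoly R[n]}, f = \sum_(i < size hs) q i * hs`_i.
Proof.
pose J : set {mpoly R[n]} :=
  [set f | exists q : nat -> {mpoly R[n]}, f = \sum_(i < size hs) q i * hs`_i].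
apply: (@ideal_gen_sub _ _ J) => [|h /= hsh].
  split.
  - by exists (fun _ => 0); rewrite big1 // => i _; rewrite mul0r.
  - move=> _ _ [p ->] [q ->]; exists (fun i => p i + q i).
    by rewrite -big_split; apply: eq_bigr => i _; rewrite mulrDl.
  - move=> p _ [q ->]; exists (fun i => p * q i).
    by rewrite mulr_sumr; apply: eq_bigr => i _; rewrite mulrA.
exists (fun i => (i == index h hs)%:R).
have ih : (index h hs < size hs)%N by rewrite index_mem.
rewrite (bigD1 (Ordinal ih)) //= eqxx mul1r nth_index // big1 ?addr0 //.
by move=> i; rewrite -val_eqE /= => /negPf ->; rewrite mul0r.
Qed.

Lemma ideal_gen_seq_bounded hs (D : nat) : exists B : nat, forall f,
  ideal_gen [set h | h \in hs] f -> degle D f ->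
  exists2 q : nat -> {mpoly R[n]}, f = \sum_(i < size hs) q i * hs`_i &
    forall i, (i < size hs)%N -> degle B (q i).
Proof.
pose V : set {mpoly R[n]} := ideal_gen [set h | h \in hs].
pose Q B : set {mpoly R[n]} := [set f | exists2 q : nat -> {mpoly R[n]},
  f = \sum_(i < size hs) q i * hs`_i &
  forall i, (i < size hs)%N -> degle B (q i)].
have idV : is_ideal V by apply: ideal_gen_ideal.
(* The strict bound [D.+1] makes the list consist of all monomials of degree at most [D]. *)
have [|||||B BP] := @uniform_bound V Q
  [seq bmnm b | b <- enum {: 'X_{1..n < D.+1}}].
- by move=> c f g Vf Vg; apply: idealB => //; apply: idealZ.
- exists (fun _ => 0) => [|i _]; last exact: wle0.
  by rewrite big1 // => i _; rewrite mul0r.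
- by move=> B B' f BB' [q fE qB]; exists q => // i /qB; apply: degleW.
- move=> B c _ _ [p -> pB] [q -> qB]; exists (fun i => p i + c *: q i).
    rewrite scaler_sumr -big_split; apply: eq_bigr => i _.
    by rewrite mulrDl scalerAl.
  by move=> i hi; apply: wleD; [apply: pB | apply: wleZ; apply: qB].
- move=> f /ideal_gen_seq[q fE]; exists (\max_(i < size hs) mtdeg (q i)).
  exists q => // i hi; apply: degleW (@degle_mtdeg (q i)).
  exact: (leq_bigmax (Ordinal hi)).
exists B => f Vf /degleP fD; apply: BP => // a /fD aD.
by apply/mapP; exists (BMultinom (aD : (mdeg a < D.+1)%N)); rewrite ?mem_enum.
Qed.

(* [q = ((q + 1) / 2)^2 - ((q - 1) / 2)^2]. *)
Lemma plus_minus_repr hs (q : nat -> {mpoly R[n]}) (B D : nat) :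
  (forall i, (i < size hs)%N -> degle B (q i)) ->
  (forall h, h \in hs -> degle D h) ->
  exists t : nat -> {mpoly R[n]}, [/\ forall i, sos (t i),
    \sum_(i < size hs) q i * hs`_i =
      \sum_(i < size (plus_minus hs)) t i * (plus_minus hs)`_i
    & forall i, (i < size (plus_minus hs))%N ->
        degle (B + B + D) (t i * (plus_minus hs)`_i)].
Proof.
elim: hs q => [|h hs IH] q qB hsD.
  by exists (fun _ => 0); split=> [i||//]; [apply: sos0 | rewrite !big_ord0].
have [i hi|k hk|t [tsos tE tB]] := IH (fun i => q i.+1).
- exact: (qB i.+1).
- by apply: hsD; rewrite inE hk orbT.
pose p : {mpoly R[n]} := 2^-1 *: (q 0%N + 1).
pose m : {mpoly R[n]} := 2^-1 *: (q 0%N - 1).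
have q0B : degle B (q 0%N) by apply: qB.
have hD : degle D h by apply: hsD; rewrite mem_head.
have pB : degle B p by apply: wleZ; apply: wleD => //; apply: degle1.
have mB : degle B m.
  by apply: wleZ; apply: wleD => //; apply: wleN; apply: degle1.
(* Positions 0 and 1 of [plus_minus (h :: hs)] hold [h] and [- h]; the remaining ones are shifted by
   two. *)
exists (fun i => match i with 0 => p ^+ 2 | 1 => m ^+ 2 | j.+2 => t j end).
split.
- by move=> [|[|i]]; [apply: sosX2 | apply: sosX2 | apply: tsos].
- rewrite (big_ord_recl (size hs)) /= -/(plus_minus hs) 2!big_ord_recl /=.
  rewrite [X in _ + X]tE addrA; congr (_ + _).
  rewrite mulrN -mulrBl; congr (_ * _).
  rewrite subr_sqr /p /m -scalerDr -scalerBr -scalerAl -scalerAr scalerA.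
  have -> : (q 0%N + 1 - (q 0%N - 1)) * (q 0%N + 1 + (q 0%N - 1)) =
      (2 * 2 : R) *: q 0%N.
    by rewrite -natrM scaler_nat; ring.
  by rewrite scalerA (_ : _ * _ = 1) ?scale1r //; field.
- move=> [|[|i]] hi.
  + by rewrite expr2; apply: degleM => //; apply: degleM.
  + rewrite expr2; apply: degleM; first exact: degleM.
    exact: wleN.
  + exact: tB.
Qed.

Lemma mem_plus_minus hs h :
  h \in plus_minus hs -> exists2 k, k \in hs & h = k \/ h = - k.
Proof.
move=> /flatten_mapP[k hsk]; rewrite !inE => /orP[]/eqP->; exists k => //.
  by left.
by right.
Qed.

End BoundedRepresentations.

(** * Stability for a positive weight *)

Section Stability.
Context {R : realType} {n : nat}.
Implicit Types (w : 'rV[R]_n) (I : set {mpoly R[n]}).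

Lemma real_radical_stable w I : is_ideal I -> (forall i, 0 < w ord0 i) ->
  is_real_radical (in_ideal w I) -> sos_plus_stable I.
Proof.
move=> idI w0 rad hs IE.
(* The defaults 1 and 0 keep [c] positive and [C] nonnegative even when [n = 0]. *)
pose c := \big[Num.min/1]_i w ord0 i.
pose C := \big[Num.max/0]_i w ord0 i.
have c0 : 0 < c by apply/bigmin_gtP; split.
have cw i : c <= w ord0 i by apply: bigmin_le.
have Cw i : w ord0 i <= C by apply: le_bigmax.
have C0 : 0 <= C by apply: bigmax_ge_id.
pose p := plus_minus hs.
suff /choice[l lP] : forall d, exists l : nat, forall f,
    mtdeg f = d -> quadratic_module p f -> exists2 s, @qm_repr R n p f s &
      forall i : 'I_(size p).+1, (mtdeg (s i * (1 :: p)`_i) <= l)%N.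
  by exists l => f _; apply: lP.
(* Total degree at most [d] gives weight at most [C * d], which is [2 * s]; conversely, weight at
   most [s] gives total degree at most [s / c], hence at most [N]. The squares then have degree at
   most [N + N], and the ideal part at most [d + (N + N)]. *)
move=> d; pose s := C * d%:R / 2; pose N := Num.bound (s / c).
have [B BP] := ideal_gen_seq_bounded hs (d + (N + N)).
pose D := \max_(h <- hs) mtdeg h.
exists (maxn (N + N) (B + B + D)) => f fd [u [usos fE]].
have Ip i : (i < size p)%N -> I p`_i.
  move=> /(mem_nth 0) /mem_plus_minus[k hsk kE].
  have Ik : I k by rewrite IE; apply: sub_ideal_gen.
  by case: kE => ->; [|apply: idealN].
rewrite big_ord_recl /= mulr1 in fE.
have [gs gsE] := usos ord0; rewrite gsE in fE.
have fs : wle w (2 * s) f.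
  move=> a /(@degle_mtdeg _ _ f); rewrite fd wdot_const mul1r => ad.
  have -> : 2 * s = C * d%:R by rewrite /s; field.
  apply: le_trans (ler_wpM2l C0 ad); rewrite -wdot_const.
  by apply: le_wdot => i; rewrite mxE.
have [|gs' [h [Ih {}fE gs's]]] := sos_plus_wle idI c0 cw rad _ fE fs.
  apply: ideal_sum => // i _; apply: idealM => //.
  by apply: Ip; apply: (ltn_ord i).
have s0 : 0 <= s / c by rewrite /s !divr_ge0 ?mulr_ge0 // ltW.
have gs'N g : g \in gs' -> degle N g.
  move=> /gs's gsg a /gsg /(le_trans (mdeg_le_wdot a cw)) ac.
  rewrite wdot_const mul1r; apply: le_trans (ltW (archi_boundP s0)).
  by rewrite ler_pdivlMr // mulrC.
have sumN : degle (N + N) (\sum_(g <- gs') g ^+ 2).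
  by apply: wle_sum => g /gs'N gN; rewrite expr2; apply: degleM.
have hD : degle (d + (N + N)) h.
  rewrite (_ : h = f - \sum_(g <- gs') g ^+ 2); last by rewrite fE; ring.
  apply: wleD; first by apply: degleW (@degle_mtdeg _ _ f); rewrite fd leq_addr.
  by apply: wleN; apply: degleW sumN; apply: leq_addl.
have [|q hE qB] := BP h _ hD; first by rewrite -IE.
have [|t [tsos tE tB]] := @plus_minus_repr _ _ hs q B D qB.
  move=> k hsk; apply: degleW (@degle_mtdeg _ _ k).
  exact: (leq_bigmax_seq _ hsk).
(* Index 0 belongs to [p_0 = 1] and takes the reduced squares; the later indices take the
   multipliers of the signed generators. *)
exists (fun i => if nat_of_ord i is j.+1 then t j else \sum_(g <- gs') g ^+ 2).
  split; first by move=> [[|i] hi] /=; [exists gs' | apply: tsos].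
  by rewrite fE big_ord_recl /= mulr1 hE tE.
move=> [[|i] hi] /=; apply: mtdeg_le.
  by rewrite mulr1; apply: degleW sumN; apply: leq_maxl.
by apply: degleW (tB i hi); apply: leq_maxr.
Qed.

End Stability.

(** * Homogeneous ideals and shifts of the weight *)

Section Homogeneous.
Context {R : realType} {n : nat}.
Implicit Types (w : 'rV[R]_n) (I : set {mpoly R[n]}).

(** A homogeneous generator factors out of a component of a product, leaving a component of its
    coefficient. *)
Lemma homogeneous_wcomp I (r : R) f :
  homogeneous_ideal I -> I f -> I (wcomp (const_mx 1) r f).
Proof.
move=> [S [Shom ->]] [k [q [g [Sg ->]]]]; rewrite linear_sum /=.
apply: (ideal_sum (ideal_gen_ideal S)) => i _.
have [d /dhomogP gd] := Shom _ (Sg i).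
rewrite (@wcompMr _ _ _ _ d%:R); last first.
  by move=> a /gd <-; rewrite wdot_const mul1r.
by apply: (idealM (ideal_gen_ideal S)); apply: sub_ideal_gen.
Qed.

(** On monomials of total degree [d] the shift adds the constant [c * d] to every weight, so it does
    not change their order. The initial form is therefore split by total degree, each homogeneous
    component of [f] being in [I]. *)
Lemma sub_in_ideal_shift I w c : is_ideal I -> homogeneous_ideal I ->
  in_ideal w I `<=` in_ideal (w + const_mx c) I.
Proof.
move=> idI homI; have idJ := ideal_gen_ideal (in_form (w + const_mx c) @` I).
apply: ideal_gen_sub => // _ [f If <-]; rewrite in_form_wcomp.
set r := wdeg w f.
pose comp (d : nat) := wcomp (const_mx 1) d%:R f.
(* A component [comp d] that does not reach weight [r] contributes 0; the range [d < msize f] covers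
   every degree in [f]. *)
have -> : wcomp w r f =
    \sum_(d < msize f) wcomp (w + const_mx c) (r + c * d%:R) (comp d).
  apply/mpolyP => a; rewrite mcoeff_wcomp raddf_sum /=.
  under eq_bigr => d _.
    rewrite !mcoeff_wcomp wdotDl !wdot_const mul1r eqr_nat.
    rewrite (_ : (if _ then _ else _) =
      if mdeg a == d then (if wdot w a == r then f@_a else 0) else 0); last first.
      have [<-|_] := eqVneq (mdeg a) d; last by rewrite if_same.
      by rewrite (inj_eq (addIr _)).
    over.
  rewrite -big_mkcond /=.
  have [fa|/memN_msupp_eq0 fa] := boolP (a \in msupp f); last first.
    by rewrite fa !if_same big1.
  by rewrite (big_pred1 (Ordinal (msize_mdeg_lt fa))).
apply: ideal_sum => // d _; apply: in_ideal_wcomp.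
  exact: homogeneous_wcomp.
move=> a; rewrite msupp_wcomp wdot_const mul1r => /andP[/eqP ad fa].
by rewrite wdotDl wdot_const ad lerD2r; apply: wle_wdeg.
Qed.

Lemma in_ideal_shift I w c : is_ideal I -> homogeneous_ideal I ->
  in_ideal (w + const_mx c) I = in_ideal w I.
Proof.
move=> idI homI; rewrite eqEsubset; split; last exact: sub_in_ideal_shift.
have := @sub_in_ideal_shift I (w + const_mx c) (- c) idI homI.
by rewrite -addrA (_ : const_mx c + const_mx (- c) = 0) ?addr0 //;
  apply/matrixP => i j; rewrite !mxE subrr.
Qed.

End Homogeneous.

Theorem corollary3p5 (R : realType) (n : nat) (I : set {mpoly R[n]})
    (idI : is_ideal I) :
  ((exists2 w : 'rV[R]_n, (forall i, 0 < w ord0 i)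
      & is_real_radical (in_ideal w I)) -> sos_plus_stable I) /\
  (homogeneous_ideal I -> real_radical_fan I !=set0 -> sos_plus_stable I).
Proof.
split=> [[w w0 rad]|homI [sigma [_ [w _ rad]]]].
  exact: real_radical_stable rad.
(* This shift makes every entry of the weight at least 1. *)
pose c := 1 - \big[Num.min/0]_i w ord0 i.
apply: (@real_radical_stable _ _ (w + const_mx c)) => //; last first.
  by rewrite in_ideal_shift.
move=> i; rewrite !mxE /c.
have : \big[Num.min/0]_i w ord0 i <= w ord0 i by apply: bigmin_le.
lra.
Qed.
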